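(* Let $b\in C^1(I_{2\varepsilon};\mathbb R)$ be such that there exists $\mathfrak m_b>0$ with $b'(x)\leqslant-\mathfrak m_b$ for every $x\in I_{2\varepsilon}$. Then there exists a constant $C>0$, depending only on $b$, $\mathfrak m_b$, $K$, $\mathtt l_0$, $\mathtt r_0$ and $\varepsilon$ (in particular not on $\ell$, $h$ nor on the estimator $\widehat b$), such that for every integrable estimator $\widehat b$ of $b$ on $I_{2\varepsilon}$ and all $\ell,h\in(0,\min\{1,\mathfrak m_b\}\varepsilon)$, $$\int_{I_0}\mathbb E(|\widetilde b_{\ell,h}(x)-b(x)|)\,dx\leqslant C\,\bigl(\ell+h+\mathfrak R(\widehat b)\bigr),\qquad\text{where}\quad \mathfrak R(\widehat b)=\sup_{x\in I_{2\varepsilon}}\mathbb E(|\widehat b(x)-b(x)|).$$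
   Context: Let $\mathtt l_0<\mathtt r_0$ be real numbers and $\varepsilon\in(0,1]$. Put $I_0=[\mathtt l_0,\mathtt r_0]$ and, for $\lambda>0$, $\mathtt l_\lambda=\mathtt l_0-\lambda$, $\mathtt r_\lambda=\mathtt r_0+\lambda$, $I_\lambda=[\mathtt l_\lambda,\mathtt r_\lambda]$. Let $K\in C^2(\mathbb R;\mathbb R_+)$ be a kernel ($\int_{\mathbb R}K=1$) which is symmetric and supported in $[-1,1]$, and for $\eta\in(0,1]$ let $K_\eta(u)=\frac1\eta K(\frac u\eta)$. An integrable estimator $\widehat b$ of $b$ on $I_{2\varepsilon}$ is a (jointly measurable) random function $\widehat b:\Omega\times I_{2\varepsilon}\to\mathbb R$ on a probability space $(\Omega,\mathcal A,\mathbb P)$, integrable on $I_{2\varepsilon}$. Define, for $w\in\mathbb R$ and $x\in I_0$, $$\widehat{\mathfrak b}_h^{-1}(w)=\mathtt l_{2\varepsilon}+\int_{I_{2\varepsilon}}\int_{-\infty}^{-w}K_h(-\widehat b(z)-y)\,dy\,dz,$$ $$\widetilde b_{\ell,h}(x)=\left(\widehat b(\mathtt r_\varepsilon)+\int_{\widehat b(\mathtt r_\varepsilon)}^{\widehat b(\mathtt l_\varepsilon)}\int_{-\infty}^{-x}K_\ell(-\widehat{\mathfrak b}_h^{-1}(z)-y)\,dy\,dz\right)\mathbf 1_{\Omega_{\widehat b}},\qquad \Omega_{\widehat b}=\left\{\widehat b(\mathtt r_\varepsilon)-\widehat b(\mathtt l_\varepsilon)\leqslant-\frac{\mathfrak m_b}{2}(\mathtt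 r_\varepsilon-\mathtt l_\varepsilon)\right\}.$$ (Here $\widehat{\mathfrak b}_h^{-1}$ is just a notation for the function so defined.) *)

(* Defs.v *)
From mathcomp Require Import all_boot all_order all_algebra.
From mathcomp Require Import all_classical all_reals all_analysis.

Set Implicit Arguments.
Unset Strict Implicit.
Unset Printing Implicit Defensive.

Import Order.TTheory GRing.Theory Num.Theory.
Import numFieldNormedType.Exports.

Local Open Scope classical_set_scope.
Local Open Scope ring_scope.

(* Differentiability relative to a set [D]: the increments stay inside [D], so
   that the derivative is one-sided at the end points of a closed interval. *)
Definition slope {R : realType} (f : R -> R) (x y : R) : R :=
  (f y - f x) / (y - x).

Definition derivable_on {R : realType} (D : set R) (f : R -> R) : Prop :=
  forall x, D x -> cvg (slope f x @ within D x^').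

Definition derive_on {R : realType} (D : set R) (f : R -> R) (x : R) : R :=
  lim (slope f x @ within D x^').

Definition C1_on {R : realType} (D : set R) (f : R -> R) : Prop :=
  derivable_on D f /\ {within D, continuous (derive_on D f)}.

Definition C2 {R : realType} (f : R -> R) : Prop :=
  [/\ forall x, derivable f x 1,
      forall x, derivable (derive1 f) x 1 &
      continuous (derive1 (derive1 f))].

Definition tsupport {R : realType} (f : R -> R) : set R :=
  closure [set u | f u != 0].

Record is_kernel {R : realType} (K : R -> R) : Prop := IsKernel {
  kernel_C2 : C2 K;
  kernel_ge0 : forall u, 0 <= K u;
  kernel_int1 : (\int[lebesgue_measure]_u (K u)%:E = 1)%E;
  kernel_sym : forall u, K (- u) = K u;
  kernel_support : tsupport K `<=` `[-1, 1] }.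

Definition rescale {R : realType} (K : R -> R) (eta : R) (u : R) : R :=
  eta^-1 * K (u / eta).

Definition lpt {R : realType} (l0 lam : R) : R := l0 - lam.
Definition rpt {R : realType} (r0 lam : R) : R := r0 + lam.
Definition Iset {R : realType} (l0 r0 lam : R) : set R :=
  `[lpt l0 lam, rpt r0 lam].

(* The integral from [a] to [c], with its sign when [c < a]. *)
Definition oriented_int {R : realType} (a c : R) (f : R -> R) : R :=
  if a <= c then \int[lebesgue_measure]_(z in `[a, c]) f z
  else - \int[lebesgue_measure]_(z in `[c, a]) f z.

(* Only the values [bhat w x] with [x] in [D] are meaningful; integrability on
   [D] is that of almost every path. *)
Record integrable_estimator {R : realType} (d : measure_display)
    (Omega : measurableType d) (P : probability Omega R) (D : set R)
    (bhat : Omega -> R -> R) : Prop := IntegrableEstimator {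
  estimator_measurable :
    measurable_fun ([set: Omega] `*` (D : set (measurableTypeR R)))
      (fun p : Omega * measurableTypeR R => bhat p.1 p.2);
  estimator_integrable :
    {ae P, forall w, lebesgue_measure.-integrable D (EFin \o bhat w)} }.

Section Estimators.
Context {R : realType} (l0 r0 eps : R) (K : R -> R).

(* The next two definitions are for one path [beta] of the estimator. *)
Definition inv_est (h : R) (beta : R -> R) (w : R) : R :=
  lpt l0 (2 * eps) +
  \int[lebesgue_measure]_(z in Iset l0 r0 (2 * eps))
    (\int[lebesgue_measure]_(y in `]-oo, - w]) rescale K h (- beta z - y)).

Definition iso_est (ell h : R) (beta : R -> R) (x : R) : R :=
  beta (rpt r0 eps) +
  oriented_int (beta (rpt r0 eps)) (beta (lpt l0 eps)) (fun z =>
    \int[lebesgue_measure]_(y in `]-oo, - x])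
      rescale K ell (- inv_est h beta z - y)).

Definition Omega_bhat (mb : R) (Omega : Type) (bhat : Omega -> R -> R) :
    set Omega :=
  [set w | bhat w (rpt r0 eps) - bhat w (lpt l0 eps)
             <= - (mb / 2) * (rpt r0 eps - lpt l0 eps)].

Definition btilde (mb ell h : R) (Omega : Type) (bhat : Omega -> R -> R)
    (w : Omega) (x : R) : R :=
  iso_est ell h (bhat w) x * \1_(Omega_bhat mb bhat) w.

End Estimators.

Definition risk {R : realType} (d : measure_display) (Omega : measurableType d)
    (P : probability Omega R) (D : set R) (b : R -> R)
    (bhat : Omega -> R -> R) : \bar R :=
  ereal_sup [set ('E_P[fun w => `|bhat w x - b x|%R])%E | x in D].

(* Main.v *)
(** For decreasing [b], both [b] and its inverse are integrals of indicators:
    [b x = b r + int_(b r)^(b l) 1_(z < b x) dz], and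
    [c z = A + int_I 1_(z < b u) du] satisfies [x < c z -> z < b x] and
    [c z < x -> b x <= z].  The estimator replaces these indicators by smoothed
    ones taken at [bhat u] and at the estimated inverse.  A smoothed indicator of
    width [h] centred at [a] is at L1-distance at most [2 h + |a - c|] from the
    indicator jumping at [c].  By Tonelli this is used twice: integrating over [x]
    the error is at most [2 ell] plus the error on the inverse, which integrated
    over [z] is at most [2 h] plus the L1 error of [bhat].  The integration limits
    cost the errors at the two end points, and so does the event where [bhat]
    does not decrease enough, since there these errors are bounded below. *)
Require Import Defs.
From mathcomp Require Import all_boot all_order all_algebra.
From mathcomp Require Import all_classical all_reals all_analysis.
From mathcomp Require Import measurable_realfun lra.
Import Order.TTheory GRing.Theory Num.Theory.
Import numFieldNormedType.Exports.
Local Open Scope classical_set_scope.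
Local Open Scope ring_scope.

(* [ge0_le_integral] without measurability: the integral of a nonnegative function
   is a supremum over the simple functions below it. *)
Lemma ge0_le_integral_nonmeasurable d (T : measurableType d) (R : realType)
    (mu : {measure set T -> \bar R}) (D : set T) (f g : T -> \bar R) :
  (forall x, D x -> 0 <= f x)%E -> (forall x, D x -> f x <= g x)%E ->
  (\int[mu]_(x in D) f x <= \int[mu]_(x in D) g x)%E.
Proof.
move=> f0 fg; rewrite !ge0_integralE//; last first.
  by move=> x Dx; exact: le_trans (f0 _ Dx) (fg _ Dx).
apply: le_ereal_sup => _ [h hf <-]; exists h => // x.
apply: (le_trans (hf x)); rewrite /patch; case: ifPn => // /set_mem; exact: fg.
Qed.

(** * Differentiability relative to a closed interval *)

(** At an interior point small increments stay inside [[a, c]], so the relative limit is the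
    ordinary one. This is what makes the mean value theorem applicable. *)
Lemma is_derive_derive_on (R : realType) (a c x : R) (f : R -> R) :
  a < x < c -> derivable_on `[a, c] f ->
  is_derive x 1 f (derive_on `[a, c] f x).
Proof.
move=> /andP[ax xc] df.
have Dx : `[a, c]%classic x by rewrite /= in_itv/= (ltW ax) (ltW xc).
have := df x Dx; set l := derive_on _ f x => /= cl.
have {}cl : slope f x @ within `[a, c] x^' --> l by exact: cl.
have H : (fun h => h^-1 *: ((f \o shift x) (h *: 1) - f x)) @ 0^' --> l.
  apply/cvgrPdist_le => e e0.
  move/cvgrPdist_le : cl => /(_ e e0).
  rewrite near_withinE => /nbhs_ballP[r /= r0 xr].
  near=> h.
  have h0 : h != 0 by near: h; exact: nbhs_dnbhs_neq.
  have -> : h^-1 *: ((f \o shift x) (h *: 1) - f x) = slope f x (h + x).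
    by rewrite /slope/= addrK /GRing.scale/= mulr1 mulrC.
  have hr : `|h| < Num.min r (Num.min (x - a) (c - x)).
    near: h; apply: dnbhs0_lt.
    by rewrite !lt_min r0 !subr_gt0 ax xc.
  move: hr; rewrite !lt_min => /and3P[hr hx hc].
  apply: xr.
  - by rewrite /ball/= opprD addrCA subrr addr0 normrN.
  - by rewrite -subr_eq0 addrK.
  - rewrite /= in_itv/=; move: hx hc; rewrite !ltr_norml => /andP[? ?] /andP[? ?].
    by apply/andP; split; lra.
apply: DeriveDef; first exact: cvgP H.
exact: cvg_lim H.
Unshelve. all: by end_near. Qed.

(** Near [x] the slopes are bounded by [|l| + 1], where [l] is their limit, which gives a Lipschitz
    estimate at [x]. It serves the mean value theorem and, later, the measurability of [b]. *)
Lemma derivable_on_continuous (R : realType) (D : set R) (f : R -> R) :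
  derivable_on D f -> {within D, continuous f}.
Proof.
move=> df; apply/subspace_continuousP => x Dx.
have cl := df x Dx.
set l := lim (slope f x @ within D x^') in cl.
apply/cvgrPdist_le => e e0.
move/cvgrPdist_le : cl => /(_ 1 ltr01).
rewrite near_withinE => /nbhs_ballP[r /= r0 xr].
rewrite near_withinE; near=> y => Dy.
have [->|yx] := eqVneq y x; first by rewrite subrr normr0 ltW.
have l1 : 0 < `|l| + 1 by rewrite ltr_wpDl.
have xyr : `|x - y| < Num.min r (e / (`|l| + 1)).
  by near: y; apply: cvgr_dist_lt => //; rewrite lt_min r0 divr_gt0.
move: xyr; rewrite lt_min => /andP[xyr xye].
have := xr y xyr yx Dy => ls.
have sl : `|slope f x y| <= `|l| + 1.
  rewrite -[slope f x y](subKr l) (le_trans (ler_normB _ _))//.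
  by rewrite lerD2l.
rewrite distrC (_ : f y - f x = slope f x y * (y - x)); last first.
  by rewrite /slope divfK// subr_eq0.
rewrite normrM distrC (le_trans (ler_wpM2r _ sl))// mulrC -ler_pdivlMr//.
exact: ltW.
Unshelve. all: by end_near. Qed.

(** Mean value theorem on [[x, y]]: the intermediate point is interior to [[a, c]]. *)
Lemma derive_on_le_decreasing (R : realType) (a c m : R) (f : R -> R) :
  derivable_on `[a, c] f ->
  (forall x, `[a, c]%classic x -> derive_on `[a, c] f x <= - m) ->
  forall x y, a <= x -> x <= y -> y <= c -> f y - f x <= - m * (y - x).
Proof.
move=> df dfm x y ax; rewrite le_eqVlt => /predU1P[<- _|xy yc].
  by rewrite !subrr mulr0.
have xycont : {within `[x, y], continuous f}.
  apply: continuous_subspaceW (derivable_on_continuous _ _ _ df) => z/=.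
  by rewrite !in_itv/= => /andP[? ?]; apply/andP; split; lra.
have [|z zxy ->] := @MVT R f (derive_on `[a, c] f) x y xy _ xycont.
  move=> z; rewrite in_itv/= => /andP[? ?]; apply: is_derive_derive_on => //.
  by apply/andP; split; lra.
move: zxy; rewrite in_itv/= => /andP[? ?].
rewrite ler_wpM2r ?subr_ge0 ?(ltW xy)//; apply: dfm.
by rewrite /= in_itv/=; apply/andP; split; lra.
Qed.

(** * Smoothed indicators built from the kernel *)

(* [smear K h (- a) (- z)] is a smoothing at scale [h] of the indicator of [z < a]:
   it differs from it only for [z] within [h] of [a]. *)
Definition smear {R : realType} (K : R -> R) (h a v : R) : R :=
  \int[lebesgue_measure]_(y in `]-oo, v]) rescale K h (a - y).

Section Kernel.
Context {R : realType} {K : R -> R} (hK : is_kernel K).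

Lemma kernel_continuous : continuous K.
Proof.
move=> x; apply/differentiable_continuous/derivable1_diffP.
by case: (kernel_C2 hK).
Qed.

Lemma kernel_eq0 u : 1 < `|u| -> K u = 0.
Proof.
move=> u1; apply/eqP/negPn/negP => Ku.
have /(kernel_support hK) : tsupport K u by exact: subset_closure.
by rewrite /= in_itv/= -ler_norml leNgt u1.
Qed.

Lemma rescale_ge0 h u : 0 < h -> 0 <= rescale K h u.
Proof.
by move=> h0; rewrite mulr_ge0// ?invr_ge0 ?(ltW h0)// (kernel_ge0 hK).
Qed.

Lemma rescale_eq0 h u : 0 < h -> h < `|u| -> rescale K h u = 0.
Proof.
move=> h0 hu; rewrite /rescale kernel_eq0 ?mulr0//.
by rewrite normrM normfV (gtr0_norm h0) ltr_pdivlMr// mul1r.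
Qed.

Lemma rescale_continuous h : continuous (rescale K h).
Proof.
move=> u; apply: (@continuousM R R (cst h^-1) (K \o (fun u => u / h))).
  exact: cst_continuous.
apply: continuous_comp; first exact: mulrr_continuous.
exact: kernel_continuous.
Qed.

(** Affine substitution [F y = (y - a) / h]. The symmetry of [K] lets an increasing [F] be used
    although the integrand is taken at [a - y]. *)
Lemma integral_rescale h a : 0 < h ->
  (\int[lebesgue_measure]_y (rescale K h (a - y))%:E = 1)%E.
Proof.
move=> h0; rewrite -(kernel_int1 hK).
pose F (y : R) : R := (y - a) / h.
have dF (x : R) : is_derive x (1 : R) F h^-1.
  rewrite (_ : F = (@id R - cst a) * cst h^-1)//.
  apply: is_derive_eq; rewrite /= scaler0 add0r subr0.
  by rewrite /GRing.scale/= mulr1.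
have F'E : F^`()%classic = cst h^-1.
  by apply/funext => x; rewrite derive1E; exact: derive_val.
rewrite (@increasing_ge0_integration_by_substitutionT _ F K).
- apply: eq_integral => y _; congr EFin; rewrite F'E /rescale.
  transitivity (K (F y) * h^-1) => //.
  by rewrite mulrC -[K (F y)](kernel_sym hK) /F -mulNr opprB.
- by move=> x y xy; rewrite /F ltr_pM2r ?invr_gt0// ltrD2r.
- by rewrite F'E; exact: cst_continuous.
- by rewrite F'E; exact: is_cvg_cst.
- by rewrite F'E; exact: is_cvg_cst.
- by move=> x; exact: ex_derive.
- apply: gt0_cvgMlNy; first by rewrite invr_gt0.
  exact: cvg_addrr_Ny.
- apply: gt0_cvgMly; first by rewrite invr_gt0.
  exact: cvg_addrr.
- exact: kernel_continuous.
- exact: (kernel_ge0 hK).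
Qed.

Lemma measurable_rescale h : measurable_fun setT (rescale K h).
Proof. by apply: continuous_measurable_fun; exact: rescale_continuous. Qed.

Lemma measurable_rescaleB h a (D : set R) :
  measurable_fun D (fun y => (rescale K h (a - y))%:E).
Proof.
apply: measurable_funTS; apply/measurable_EFinP.
apply: (measurableT_comp (measurable_rescale h)).
exact: measurable_funB.
Qed.

Lemma integral_rescale_le1 h a (D : set R) : 0 < h -> measurable D ->
  (\int[lebesgue_measure]_(y in D) (rescale K h (a - y))%:E <= 1)%E.
Proof.
move=> h0 mD; rewrite -(integral_rescale h a h0).
apply: ge0_subset_integral => //; first exact: measurable_rescaleB.
by move=> y _; rewrite lee_fin rescale_ge0.
Qed.

Lemma smearE h a v : 0 < h ->
  (\int[lebesgue_measure]_(y in `]-oo, v]) (rescale K h (a - y))%:E =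
   (smear K h a v)%:E)%E.
Proof.
move=> h0; rewrite /smear /Rintegral fineK// ge0_fin_numE.
  by rewrite (le_lt_trans (integral_rescale_le1 _ _ _ h0 _))// ltry.
by apply: integral_ge0 => y _; rewrite lee_fin rescale_ge0.
Qed.

Lemma smear_ge0 h a v : 0 < h -> 0 <= smear K h a v.
Proof. by move=> h0; apply: Rintegral_ge0 => y _; exact: rescale_ge0. Qed.

Lemma smear_le1 h a v : 0 < h -> smear K h a v <= 1.
Proof. by move=> h0; rewrite -lee_fin -smearE// integral_rescale_le1. Qed.

Lemma smear_eq0 h a v : 0 < h -> v < a - h -> smear K h a v = 0.
Proof.
move=> h0 va; apply/EFin_inj; rewrite -smearE// integral0_eq// => y.
rewrite /= in_itv/= => yv; rewrite rescale_eq0//.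
by rewrite ltr_normr; apply/orP; left; lra.
Qed.

(** The half-line then contains the whole support of the rescaled kernel, hence its whole mass. *)
Lemma smear_eq1 h a v : 0 < h -> a + h < v -> smear K h a v = 1.
Proof.
move=> h0 va; apply/EFin_inj; rewrite -smearE// -(integral_rescale h a h0).
rewrite integral_mkcond; apply: eq_integral => y _; rewrite /patch.
case: ifPn => // /negP yv; rewrite rescale_eq0//.
rewrite ltr_normr; apply/orP; right.
by move: yv; rewrite inE/= in_itv/= => /negP; rewrite -ltNge => ?; lra.
Qed.

(** The half-line depends on [v]. Writing it as a test inside the integrand [f] fixes the domain of
    integration, and the measurability part of Tonelli's theorem applies. *)
Lemma measurable_smear h : 0 < h ->
  measurable_fun setT (fun p : measurableTypeR R * measurableTypeR R =>
    smear K h p.1 p.2).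
Proof.
move=> h0; apply/measurable_EFinP.
pose f (q : (measurableTypeR R * measurableTypeR R) * measurableTypeR R) :=
  if q.2 <= q.1.2 then (rescale K h (q.1.1 - q.2))%:E else 0%E.
have f0 q : (0 <= f q)%E.
  by rewrite /f; case: ifP => // _; rewrite lee_fin rescale_ge0.
have mf : measurable_fun setT f.
  have m11 : measurable_fun setT
      (fun q : (measurableTypeR R * measurableTypeR R) * measurableTypeR R =>
         q.1.1 : R).
    exact: (measurableT_comp measurable_fst measurable_fst).
  have m12 : measurable_fun setT
      (fun q : (measurableTypeR R * measurableTypeR R) * measurableTypeR R =>
         q.1.2 : R).
    exact: (measurableT_comp measurable_snd measurable_fst).
  apply: measurable_fun_ifT => //.
    exact: measurable_fun_ler.
  apply/measurable_EFinP; apply: (measurableT_comp (measurable_rescale h)).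
  exact: measurable_funB.
have := measurable_fun_fubini_tonelli_F (m2 := @lebesgue_measure R) f mf f0.
congr measurable_fun; apply/funext => p; rewrite /fubini_F /= -smearE//.
rewrite [RHS]integral_mkcond; apply: eq_integral => y _.
rewrite /f/= /patch mem_setE /= in_itv/=.
by case: ifP.
Qed.
End Kernel.

(** * L1 distance between a smoothed indicator and a step *)

(** A point further than [h] from [a] and not between [a] and [c] lies on the same side of both,
    where [g] and [s] take the same value. Elsewhere the difference is at most 1. *)
Lemma step_error_le_indic (R : realType) (a h c x g s : R) :
  0 < h -> 0 <= g <= 1 -> 0 <= s <= 1 ->
  (x < a - h -> g = 1) -> (a + h < x -> g = 0) ->
  (x < c -> s = 1) -> (c < x -> s = 0) ->
  `|g - s| <= \1_`[a - h, a + h] x + \1_`[Num.min a c, Num.max a c] x.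
Proof.
move=> h0 /andP[g0 g1] /andP[s0 s1] gl gr sl sr.
have gs1 : `|g - s| <= 1 by rewrite ler_norml; apply/andP; split; lra.
have i0 (D : set R) : 0 <= \1_D x :> R by rewrite indicE.
have [hx|hx] := boolP (x \in `[a - h, a + h]%classic).
  by rewrite !indicE hx (le_trans gs1)// lerDl ler0n.
have [hc|hc] := boolP (x \in `[Num.min a c, Num.max a c]%classic).
  by rewrite !indicE hc (le_trans gs1)// lerDr ler0n.
rewrite (_ : g = s) ?subrr ?normr0 ?addr_ge0//.
move: hx hc; rewrite !mem_setE !in_itv/= ge_min le_max !negb_and !negb_or -!ltNge.
move=> /orP[xa|ax] /orP[|]/andP[? ?].
- by rewrite gl// sl//; lra.
- exfalso; lra.
- exfalso; lra.
- by rewrite gr// sr//; lra.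
Qed.

Lemma integral_indic_itv (R : realType) (p q : R) : p <= q ->
  (\int[lebesgue_measure]_x (\1_(`[p, q]%classic : set R) x)%:E = (q - p)%:E)%E.
Proof.
move=> pq; rewrite integral_indic// setIT /= lebesgue_measure_itv/= lte_fin.
case: ltP => // qp; have -> : p = q by apply/le_anti/andP.
by rewrite subrr.
Qed.

Lemma integral_indic_minmax (R : realType) (a c : R) :
  (\int[lebesgue_measure]_x
     (\1_(`[Num.min a c, Num.max a c]%classic : set R) x)%:E = `|a - c|%:E)%E.
Proof.
rewrite integral_indic_itv; last by rewrite ge_min le_max lexx.
congr EFin; rewrite minEle maxEle; case: leP => ac.
  by rewrite distrC ger0_norm ?subr_ge0.
by rewrite gtr0_norm ?subr_gt0.
Qed.

Lemma measurable_EFin_indic d (T : measurableType d) (R : realType) (A : set T) :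
  measurable A -> measurable_fun setT (fun x => (\1_A x : R)%:E).
Proof. by move=> mA; apply/measurable_EFinP; exact: measurable_indic. Qed.

(** The bound is the sum of the lengths of the two intervals of [step_error_le_indic]. The jump of
    [s] is prescribed on [D] only, and its value at [c] is left free, because this is all that the
    comparison with [level_inv] provides. *)
Lemma smear_step_error (R : realType) (K : R -> R) (h a c : R) (D : set R)
    (s : R -> R) :
  is_kernel K -> 0 < h -> measurable D ->
  (forall x, 0 <= s x <= 1) ->
  (forall x, D x -> x < c -> s x = 1) -> (forall x, D x -> c < x -> s x = 0) ->
  (\int[lebesgue_measure]_(x in D) `|smear K h (- a) (- x) - s x|%:E
     <= (2 * h + `|a - c|)%:E)%E.
Proof.
move=> hK h0 mD s01 sl sr.
pose f x : R := \1_(`[a - h, a + h]%classic : set R) x.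
pose g x : R := \1_(`[Num.min a c, Num.max a c]%classic : set R) x.
have f0 x : (0 <= (f x)%:E)%E by rewrite lee_fin /f indicE.
have g0 x : (0 <= (g x)%:E)%E by rewrite lee_fin /g indicE.
have mf : measurable_fun setT (fun x => (f x)%:E) by exact: measurable_EFin_indic.
have mg : measurable_fun setT (fun x => (g x)%:E) by exact: measurable_EFin_indic.
apply: (@le_trans _ _ (\int[lebesgue_measure]_(x in D) ((f x)%:E + (g x)%:E))%E).
  apply: ge0_le_integral_nonmeasurable => [x _|x Dx]; first by rewrite lee_fin.
  rewrite -EFinD lee_fin; apply: step_error_le_indic => //.
  - by rewrite smear_ge0// smear_le1.
  - by move=> ?; apply: smear_eq1 => //; lra.
  - by move=> ?; apply: smear_eq0 => //; lra.
  - exact: sl.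
  - exact: sr.
apply: (@le_trans _ _ (\int[lebesgue_measure]_x ((f x)%:E + (g x)%:E))%E).
  apply: ge0_subset_integral => //; first exact: emeasurable_funD.
  by move=> x _; rewrite adde_ge0.
rewrite ge0_integralD//.
rewrite integral_indic_itv; last lra.
rewrite integral_indic_minmax -EFinD lee_fin lerD2r; lra.
Qed.

(** * Tonelli's theorem on measurable rectangles *)

Lemma measurable_integral_section d1 d2 (T1 : measurableType d1)
    (T2 : measurableType d2) (R : realType)
    (m2 : {sigma_finite_measure set T2 -> \bar R}) (D2 : set T2)
    (f : T1 * T2 -> \bar R) :
  measurable D2 -> measurable_fun setT f -> (forall p, 0 <= f p)%E ->
  measurable_fun setT (fun x => \int[m2]_(y in D2) f (x, y))%E.
Proof.
move=> mD2 mf f0; pose D := [set: T1] `*` D2.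
have mD : measurable D by exact: measurableX.
have mfD : measurable_fun setT (f \_ D).
  by apply/(measurable_restrictT _ mD); exact: measurable_funTS.
have fD0 p : (0 <= (f \_ D) p)%E by exact: erestrict_ge0.
have := measurable_fun_fubini_tonelli_F (m2 := m2) _ mfD fD0.
congr measurable_fun; apply/funext => x; rewrite /fubini_F [RHS]integral_mkcond.
apply: eq_integral => y _; rewrite /patch.
by congr (if _ then _ else _); apply/idP/idP; rewrite !inE /D/= => // -[].
Qed.

(** Tonelli's theorem on the whole product, applied to [f] extended by zero outside [D1]*[D2]. *)
Lemma fubini_tonelli_on d1 d2 (T1 : measurableType d1)
    (T2 : measurableType d2) (R : realType)
    (m1 : {sigma_finite_measure set T1 -> \bar R})
    (m2 : {sigma_finite_measure set T2 -> \bar R}) (D1 : set T1) (D2 : set T2)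
    (f : T1 * T2 -> \bar R) :
  measurable D1 -> measurable D2 ->
  measurable_fun setT f -> (forall p, 0 <= f p)%E ->
  (\int[m1]_(x in D1) \int[m2]_(y in D2) f (x, y) =
   \int[m2]_(y in D2) \int[m1]_(x in D1) f (x, y))%E.
Proof.
move=> mD1 mD2 mf f0; pose D := D1 `*` D2.
have mD : measurable D by exact: measurableX.
have mfD : measurable_fun setT (f \_ D).
  by apply/(measurable_restrictT _ mD); exact: measurable_funTS.
have fD0 p : (0 <= (f \_ D) p)%E by exact: erestrict_ge0.
have DE x y : ((x, y) \in D) = (x \in D1) && (y \in D2).
  by apply/idP/andP; rewrite !inE.
have := fubini_tonelli (m1 := m1) (m2 := m2) _ mfD fD0.
congr (_ = _); rewrite [RHS]integral_mkcond; apply: eq_integral => x _.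
  rewrite [RHS]/patch; case: ifPn => xD.
    by rewrite [RHS]integral_mkcond; apply: eq_integral => y _; rewrite /patch DE xD.
  by apply: integral0_eq => y _; rewrite /patch DE (negbTE xD).
rewrite [RHS]/patch; case: ifPn => xD.
  by rewrite [RHS]integral_mkcond; apply: eq_integral => y _; rewrite /patch DE xD andbT.
by apply: integral0_eq => y _; rewrite /patch DE (negbTE xD) andbF.
Qed.

(** * Integrals over compact intervals of functions with values in [[0, 1]] *)

Lemma integrable_bounded1 (R : realType) (p q : R) (f : R -> R) :
  measurable_fun setT f -> (forall x, 0 <= f x <= 1) ->
  lebesgue_measure.-integrable `[p, q] (EFin \o f).
Proof.
move=> mf f01; apply: measurable_bounded_integrable => //.
- by rewrite /= lebesgue_measure_itv/=; case: ifP => // _; rewrite ltry.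
- exact: measurable_funTS.
- exists 1; split; first exact: num_real.
  move=> x x1 y _; apply: le_trans (ltW x1); have /andP[f0 f1] := f01 y.
  by rewrite ger0_norm.
Qed.

(** A point of [[p, q]] outside [[p', q']] lies between [p] and [p'] or between [q] and [q'], and
    there [g] is at most 1. The end points may be in any order. *)
Lemma integral_itv_le_shift (R : realType) (g : R -> R) (p q p' q' : R) :
  measurable_fun setT g -> (forall x, 0 <= g x <= 1) ->
  (\int[lebesgue_measure]_(z in `[p, q]) (g z)%:E <=
   \int[lebesgue_measure]_(z in `[p', q']) (g z)%:E + (`|p - p'| + `|q - q'|)%:E)%E.
Proof.
move=> mg g01.
pose ip x : R := \1_(`[Num.min p p', Num.max p p']%classic : set R) x.
pose iq x : R := \1_(`[Num.min q q', Num.max q q']%classic : set R) x.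
have ip0 x : (0 <= (ip x)%:E)%E by rewrite lee_fin /ip indicE.
have iq0 x : (0 <= (iq x)%:E)%E by rewrite lee_fin /iq indicE.
have mip : measurable_fun setT (fun x => (ip x)%:E) by exact: measurable_EFin_indic.
have miq : measurable_fun setT (fun x => (iq x)%:E) by exact: measurable_EFin_indic.
have g0 x : (0 <= (g x)%:E)%E by rewrite lee_fin; case/andP: (g01 x).
have G0 x (D : set R) : (0 <= ((fun z => (g z)%:E) \_ D) x)%E by exact: erestrict_ge0.
have mG (D : set R) : measurable D -> measurable_fun setT ((fun z => (g z)%:E) \_ D).
  move=> mD; apply/(measurable_restrictT _ mD); apply: measurable_funTS.
  exact/measurable_EFinP.
rewrite EFinD -!integral_indic_minmax integral_mkcond [X in (_ <= X + _)%E]integral_mkcond.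
rewrite -ge0_integralD// -ge0_integralD//; last 3 first.
- exact: mG.
- by move=> x _; rewrite adde_ge0.
- exact: emeasurable_funD.
apply: ge0_le_integral_nonmeasurable => [x _|x _]; first exact: G0.
rewrite /patch !mem_setE !in_itv/= !indicE !mem_setE !in_itv/= !ge_min !le_max.
have := g01 x; move=> /andP[gx0 gx1].
case: ifPn => pq; last by case: ifPn => _; rewrite ?add0e -!EFinD lee_fin ?addr_ge0.
case: ifPn => pq'; first by rewrite -!EFinD lee_fin lerDl addr_ge0.
rewrite add0e -EFinD lee_fin (le_trans gx1)//.
move: pq pq' => /andP[-> ->]; rewrite negb_and -!ltNge => /orP[/ltW ->|/ltW ->].
  by rewrite orbT/= lerDl ler0n.
by rewrite !orbT/= lerDr ler0n.
Qed.

Lemma EFin_Rintegral_bounded1 (R : realType) (p q : R) (f : R -> R) :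
  measurable_fun setT f -> (forall x, 0 <= f x <= 1) ->
  ((\int[lebesgue_measure]_(x in `[p, q]) f x)%:E =
   \int[lebesgue_measure]_(x in `[p, q]) (f x)%:E)%E.
Proof.
move=> mf f01; rewrite /Rintegral fineK//.
by apply: integrable_fin_num => //; exact: integrable_bounded1.
Qed.

Lemma dist_Rintegral_bounded1 (R : realType) (p q : R) (f g : R -> R) :
  measurable_fun setT f -> (forall x, 0 <= f x <= 1) ->
  measurable_fun setT g -> (forall x, 0 <= g x <= 1) ->
  (`|\int[lebesgue_measure]_(x in `[p, q]) f x -
     \int[lebesgue_measure]_(x in `[p, q]) g x|%:E <=
   \int[lebesgue_measure]_(x in `[p, q]) `|f x - g x|%:E)%E.
Proof.
move=> mf f01 mg g01.
have mI : measurable (`[p, q]%classic : set (measurableTypeR R)).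
  exact: measurable_itv.
have fi := integrable_bounded1 _ p q _ mf f01.
have gi := integrable_bounded1 _ p q _ mg g01.
rewrite -RintegralB//.
have <- := EFin_Rintegral_bounded1 _ p q (fun x => `|f x - g x|).
- rewrite lee_fin; apply: le_normr_Rintegral => //.
  exact: (integrableB mI fi gi).
- by apply: measurableT_comp => //; exact: measurable_funB.
- move=> x; rewrite normr_ge0/= ler_norml.
  move: (f01 x) (g01 x) => /andP[? ?] /andP[? ?].
  by apply/andP; split; lra.
Qed.

(** * Step functions and measurability of the estimated inverse *)

Lemma smear01 (R : realType) (K : R -> R) h a v : is_kernel K -> 0 < h ->
  0 <= smear K h a v <= 1.
Proof. by move=> hK h0; rewrite smear_ge0// smear_le1. Qed.

Lemma measurable_smear_opp d (T : measurableType d) (R : realType) (K : R -> R)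
    h (f g : T -> R) :
  is_kernel K -> 0 < h -> measurable_fun setT f -> measurable_fun setT g ->
  measurable_fun setT (fun t => smear K h (- f t) (- g t)).
Proof.
move=> hK h0 mf mg.
apply: (measurableT_comp (measurable_smear hK h h0)
  (g := fun t => (- f t, - g t))).
by apply: measurable_fun_pair; exact: measurable_funN.
Qed.

(** In [u] this is the indicator of a superlevel set of [f], in [z] a step jumping down at [f u].
    Exchanging integrals passes from one reading to the other. *)
Definition level {R : realType} (f : R -> R) (z u : R) : R :=
  if z < f u then 1 else 0.

Lemma level01 (R : realType) (f : R -> R) z u : 0 <= level f z u <= 1.
Proof. by rewrite /level; case: ifP; rewrite lexx ?ler01. Qed.

Lemma measurable_level d (T : measurableType d) (R : realType) (b : R -> R)
    (f g : T -> R) :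
  measurable_fun setT b -> measurable_fun setT f -> measurable_fun setT g ->
  measurable_fun setT (fun t => level b (f t) (g t)).
Proof.
move=> mb mf mg; apply: measurable_fun_ifT => //.
by apply: measurable_fun_ltr => //; exact: measurableT_comp.
Qed.

(** Joint measurability in the path and the level, again from Tonelli's theorem. The parameter space
    [T] is later the probability space, or [unit] when a single path is studied. *)
Lemma measurable_inv_est d (T : measurableType d) (R : realType)
    (l0 r0 eps : R) (K : R -> R) (beta : T -> R -> R) h :
  is_kernel K -> 0 < h ->
  measurable_fun setT (fun p : T * measurableTypeR R => beta p.1 p.2) ->
  measurable_fun setT (fun p : T * measurableTypeR R =>
    inv_est l0 r0 eps K h (beta p.1) p.2).
Proof.
move=> hK h0 mbeta; apply: measurable_funD => //.
apply/measurable_EFinP.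
pose f (q : (T * measurableTypeR R) * measurableTypeR R) :=
  (smear K h (- beta q.1.1 q.2) (- q.1.2))%:E.
have f0 q : (0 <= f q)%E by rewrite lee_fin smear_ge0.
have m11 : measurable_fun setT
    (fun q : (T * measurableTypeR R) * measurableTypeR R => q.1.1).
  exact: (measurableT_comp measurable_fst measurable_fst).
have m12 : measurable_fun setT
    (fun q : (T * measurableTypeR R) * measurableTypeR R => q.1.2).
  exact: (measurableT_comp measurable_snd measurable_fst).
have mf : measurable_fun setT f.
  apply/measurable_EFinP; apply: measurable_smear_opp => //.
  apply: (measurableT_comp mbeta
    (g := fun q : (T * measurableTypeR R) * measurableTypeR R => (q.1.1, q.2))).
  exact: measurable_fun_pair.
have mI : measurable (Iset l0 r0 (2 * eps)) by exact: measurable_itv.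
have := measurable_integral_section _ _ _ _ _ (@lebesgue_measure R) _ _ mI mf f0.
congr measurable_fun; apply/funext => -[w z].
rewrite /= EFin_Rintegral_bounded1//; last by move=> u; exact: smear01.
apply: measurable_smear_opp => //.
apply: (measurableT_comp mbeta (g := fun u : measurableTypeR R => (w, u))).
exact: measurable_fun_pair.
Qed.

(** * The inverse of [b] as an integral of indicators *)

(* The layer-cake form of the inverse of [b] on its range; unlike the inverse, it
   makes sense for every [z] and has the shape of [inv_est]. *)
Definition level_inv {R : realType} (l0 r0 eps : R) (b : R -> R) (z : R) : R :=
  lpt l0 (2 * eps) +
  \int[lebesgue_measure]_(u in Iset l0 r0 (2 * eps)) level b z u.

Section LevelInv.
Context {R : realType} {l0 r0 eps : R}.
Let A := lpt l0 (2 * eps).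
Let C := rpt r0 (2 * eps).
Context {b : R -> R} (mb : measurable_fun setT b).
Hypothesis b_anti : forall x y, A <= x -> x <= y -> y <= C -> b y <= b x.

Lemma level_invE z :
  ((level_inv l0 r0 eps b z - A)%:E =
   \int[lebesgue_measure]_(u in `[A, C]) (level b z u)%:E)%E.
Proof.
rewrite /level_inv addrAC subrr add0r EFin_Rintegral_bounded1//.
  exact: measurable_level.
by move=> u; exact: level01.
Qed.

(** By contraposition: if [b x <= z], monotonicity makes [level b z] vanish on [[A, C]] beyond [x],
    so its integral is at most [x - A]. *)
Lemma lt_level_inv x z : A <= x <= C -> x < level_inv l0 r0 eps b z -> z < b x.
Proof.
move=> /andP[Ax xC]; apply: contraTT; rewrite -!leNgt => bxz.
rewrite -(lerD2r (- A)) -lee_fin level_invE -integral_indic_itv//.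
rewrite integral_mkcond; apply: ge0_le_integral_nonmeasurable => [u _|u _].
  by apply: erestrict_ge0 => y _; rewrite lee_fin; case/andP: (level01 _ b z y).
rewrite /patch mem_setE indicE mem_setE !in_itv/=.
case: ifPn => [/andP[Au uC]|_]; rewrite lee_fin// Au/= /level.
case: (leP u x) => [_|xu]; first by case: ifP.
by rewrite ltNge (le_trans _ bxz)//; apply: b_anti => //; exact: ltW.
Qed.

(** By contraposition: if [z < b x], the superlevel set contains [[A, x]], so the integral is at
    least [x - A]. With [lt_level_inv], this makes [level b z] a step in [x] jumping at
    [level_inv]. *)
Lemma gt_level_inv x z : A <= x <= C -> level_inv l0 r0 eps b z < x -> b x <= z.
Proof.
move=> /andP[Ax xC]; apply: contraTT; rewrite -leNgt -ltNge => bxz.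
rewrite -(lerD2r (- A)) -lee_fin level_invE -integral_indic_itv//.
rewrite [in leRHS]integral_mkcond.
apply: ge0_le_integral_nonmeasurable => [u _|u _]; first by rewrite lee_fin indicE.
rewrite /patch mem_setE indicE mem_setE !in_itv/=.
case: (boolP (A <= u <= x)) => [/andP[Au ux]|_]; last first.
  by case: ifP => _; rewrite lee_fin; case/andP: (level01 _ b z u).
rewrite Au (le_trans ux xC)/= lee_fin /level.
by rewrite (lt_le_trans bxz)//; exact: b_anti.
Qed.

Lemma dist_inv_est_level_inv (K : R -> R) (beta : R -> R) h z :
  is_kernel K -> 0 < h -> measurable_fun setT beta ->
  (`|inv_est l0 r0 eps K h beta z - level_inv l0 r0 eps b z|%:E <=
   \int[lebesgue_measure]_(u in `[A, C])
      `|smear K h (- beta u) (- z) - level b z u|%:E)%E.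
Proof.
move=> hK h0 mbeta; rewrite /inv_est /level_inv opprD addrACA subrr add0r.
apply: dist_Rintegral_bounded1 => [|u||u].
- exact: measurable_smear_opp.
- exact: smear01.
- exact: measurable_level.
- exact: level01.
Qed.

End LevelInv.

(** * Pointwise error for one path *)

(** With [p = b rp], [q = b lp] and [v = b x] this is the layer-cake formula for [b x], the exact
    counterpart of [iso_est]. *)
Lemma Rintegral_step (R : realType) (p q v : R) : p <= v <= q ->
  \int[lebesgue_measure]_(z in `[p, q]) (if z < v then 1 else 0 : R) = v - p.
Proof.
move=> /andP[pv vq]; apply/EFin_inj; rewrite EFin_Rintegral_bounded1//; last 2 first.
- by apply: measurable_fun_ifT => //; exact: measurable_fun_ltr.
- by move=> x; case: ifP; rewrite lexx ler01.
transitivity (\int[lebesgue_measure]_z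
    (\1_(`[p, v[%classic : set R) z)%:E)%E.
  rewrite integral_mkcond; apply: eq_integral => z _.
  rewrite /patch indicE !mem_setE !in_itv/=.
  by case: (p <= z); case: (ltP z v) => zv; rewrite ?(le_trans (ltW zv) vq)//; case: ifP.
rewrite integral_indic// setIT /= lebesgue_measure_itv/= lte_fin.
case: ltP => // vp; have -> : p = v by apply/le_anti/andP.
by rewrite subrr.
Qed.

(** The error splits into the change of the additive term, the change of the limits of integration
    and the change of integrand. The point [p] is both additive term and limit, hence its factor
    2. *)
Lemma dist_iso (R : realType) (g : R -> R) (p q br bl v : R) :
  measurable_fun setT g -> (forall x, 0 <= g x <= 1) -> br <= v <= bl ->
  (`|p + \int[lebesgue_measure]_(z in `[p, q]) g z - v|%:E <=
   (`|p - br| *+ 2 + `|q - bl|)%:E +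
   \int[lebesgue_measure]_(z in `[br, bl]) `|g z - (if z < v then 1 else 0)|%:E)%E.
Proof.
move=> mg g01 brv.
set X := \int[lebesgue_measure]_(z in `[p, q]) g z.
set Y := \int[lebesgue_measure]_(z in `[br, bl]) g z.
set S := \int[lebesgue_measure]_(z in `[br, bl]) (if z < v then 1 else 0 : R).
have SE : S = v - br by exact: Rintegral_step.
have YS : (`|Y - S|%:E <= \int[lebesgue_measure]_(z in `[br, bl])
    `|g z - (if z < v then 1 else 0)|%:E)%E.
  apply: dist_Rintegral_bounded1 => //.
    by apply: measurable_fun_ifT => //; exact: measurable_fun_ltr.
  by move=> x; case: ifP; rewrite lexx ler01.
have XY : `|X - Y| <= `|p - br| + `|q - bl|.
  have := integral_itv_le_shift _ g p q br bl mg g01.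
  have := integral_itv_le_shift _ g br bl p q mg g01.
  rewrite -!EFin_Rintegral_bounded1// -!EFinD !lee_fin -/X -/Y.
  rewrite (distrC br) (distrC bl) => ? ?.
  by rewrite ler_norml; apply/andP; split; lra.
apply: le_trans (leeD2l _ YS); rewrite -EFinD lee_fin.
rewrite (_ : _ - v = (p - br) + (X - Y) + (Y - S)); last by rewrite SE; lra.
rewrite (le_trans (ler_normD _ _))// lerD2r (le_trans (ler_normD _ _))//.
by rewrite mulr2n -addrA lerD2l.
Qed.

Section PathError.
Context {R : realType} {l0 r0 eps : R} {K : R -> R} (hK : is_kernel K).
Context {b : R -> R}.

Let rp := rpt r0 eps.
Let lp := lpt l0 eps.

(** The two summands of the constant serve two cases: the quotient pays for the error off
    [Omega_bhat], where [btilde] vanishes, and 2 comes from [dist_iso] on [Omega_bhat]. *)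
Lemma path_error (mb ell h M : R) (Omega : Type) (bhat : Omega -> R -> R) w x :
  0 < ell -> 0 < h -> 0 < mb * (rp - lp) -> 0 <= M ->
  measurable_fun setT (bhat w) ->
  b rp <= b x <= b lp -> b rp - b lp <= - mb * (rp - lp) -> `|b x| <= M ->
  (`|btilde l0 r0 eps K mb ell h bhat w x - b x|%:E <=
   ((M / (mb / 2 * (rp - lp)) + 2) *
     (`|bhat w rp - b rp| + `|bhat w lp - b lp|))%:E +
   \int[lebesgue_measure]_(z in `[b rp, b lp])
      `|smear K ell (- inv_est l0 r0 eps K h (bhat w) z) (- x) - level b z x|%:E)%E.
Proof.
move=> ell0 h0 kap0 M0 mbeta bx brl bM.
set kap := mb / 2 * (rp - lp).
have {}kap0 : 0 < kap by rewrite /kap; lra.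
rewrite /btilde; set e1 := `|_ - b rp|; set e2 := `|_ - b lp|.
have e10 : 0 <= e1 by exact: normr_ge0.
have e20 : 0 <= e2 by exact: normr_ge0.
have Mk0 : 0 <= M / kap * (e1 + e2).
  by apply: mulr_ge0; [apply: divr_ge0 => //; exact: ltW|exact: addr_ge0].
have [/set_mem wO|wO] := boolP (w \in Omega_bhat l0 r0 eps mb bhat); last first.
  rewrite indicE (negbTE wO) mulr0 sub0r normrN.
  rewrite -[leLHS]adde0 leeD//; last by apply: integral_ge0 => z _; rewrite lee_fin.
  rewrite lee_fin (le_trans bM)// mulrDl ler_wpDr//.
    by rewrite mulr_ge0// addr_ge0.
  (* Off Omega_bhat the two end point errors add up to at least
     m / 2 * (rp - lp), which pays for the bound M on |b|. *)
  rewrite mulrAC -mulrA ler_peMr// ler_pdivlMr// mul1r.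
  move/negP: wO; rewrite inE /Omega_bhat/= => /negP; rewrite -ltNge -/rp -/lp => wO.
  have : `|(bhat w rp - b rp) - (bhat w lp - b lp)| <= e1 + e2 by exact: ler_normB.
  by move/ler_normlW; rewrite /kap; move: wO; lra.
rewrite indicE mem_set// mulr1 /iso_est /oriented_int.
(* The condition defining [Omega_bhat] orders the limits, so the oriented integral is an ordinary
   one. *)
have prpl : bhat w rp <= bhat w lp.
  by move: wO; rewrite /Omega_bhat/= -/rp -/lp -mulNr; move: kap0; rewrite /kap; lra.
rewrite prpl.
pose g z := smear K ell (- inv_est l0 r0 eps K h (bhat w) z) (- x).
have mg : measurable_fun setT g.
  apply: measurable_smear_opp => //.
  have mu : measurable_fun setT (fun p : unit * measurableTypeR R => bhat w p.2).
    exact: measurableT_comp.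
  have mt : measurable_fun setT (fun u : measurableTypeR R => (tt, u)).
    exact: measurable_fun_pair.
  exact (measurableT_comp
    (measurable_inv_est _ _ _ l0 r0 eps K (fun _ => bhat w) h hK h0 mu) mt).
have g01 z : 0 <= g z <= 1 by exact: smear01.
apply: le_trans (dist_iso _ g _ _ _ _ _ mg g01 bx) _.
rewrite leeD2r// lee_fin -/e1 -/e2.
move: Mk0; rewrite mulrDl; lra.
Qed.
End PathError.

(** * Error integrated over the interval and over the probability space *)

Lemma integral_cst_itv (R : realType) (p q : R) (c : \bar R) : p <= q ->
  (\int[lebesgue_measure]_(x in `[p, q]) c = c * (q - p)%:E)%E.
Proof.
move=> pq; rewrite integral_cst//= lebesgue_measure_itv/= lte_fin.
by case: ltP => // qp; congr (_ * _)%E; congr EFin; lra.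
Qed.

Section Integrated.
Context {R : realType} {l0 r0 eps : R} (hlr : l0 < r0) (heps0 : 0 < eps).
Context {K : R -> R} (hK : is_kernel K).
Context {b : R -> R} (mb : measurable_fun setT b).
Let A := lpt l0 (2 * eps).
Let C := rpt r0 (2 * eps).
Let rp := rpt r0 eps.
Let lp := lpt l0 eps.
Hypothesis b_anti : forall x y, A <= x -> x <= y -> y <= C -> b y <= b x.

Let AC : A <= C.
Proof. by rewrite /A /C /lpt /rpt; have := hlr; have := heps0; lra. Qed.

Let brl : b rp <= b lp.
Proof.
by apply: b_anti; rewrite /A /C /lp /rp /lpt /rpt; have := hlr; have := heps0; lra.
Qed.

Lemma integrated_path_error ell h (beta : R -> R) :
  0 < ell -> 0 < h -> measurable_fun setT beta ->
  (\int[lebesgue_measure]_(x in `[l0, r0])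
     \int[lebesgue_measure]_(z in `[b rp, b lp])
       `|smear K ell (- inv_est l0 r0 eps K h beta z) (- x) - level b z x|%:E <=
   (2 * ell * (b lp - b rp) + 2 * h * (C - A))%:E +
   \int[lebesgue_measure]_(u in `[A, C]) `|beta u - b u|%:E)%E.
Proof.
move=> ell0 h0 mbeta.
pose F1 (p : measurableTypeR R * measurableTypeR R) :=
  `|smear K ell (- inv_est l0 r0 eps K h beta p.2) (- p.1) - level b p.2 p.1|%:E.
pose F2 (p : measurableTypeR R * measurableTypeR R) :=
  `|smear K h (- beta p.2) (- p.1) - level b p.1 p.2|%:E.
have F10 p : (0 <= F1 p)%E by rewrite lee_fin.
have F20 p : (0 <= F2 p)%E by rewrite lee_fin.
have mt : measurable_fun setT (fun p : measurableTypeR R * measurableTypeR R => (tt, p.2)).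
  exact: measurable_fun_pair.
have mbeta' : measurable_fun setT (fun p : unit * measurableTypeR R => beta p.2).
  exact: measurableT_comp.
have mF1 : measurable_fun setT F1.
  apply/measurable_EFinP; apply: measurableT_comp => //.
  apply: measurable_funB; last exact: measurable_level.
  apply: measurable_smear_opp => //.
  exact (measurableT_comp
    (measurable_inv_est _ _ _ l0 r0 eps K (fun _ => beta) h hK h0 mbeta') mt).
have mF2 : measurable_fun setT F2.
  apply/measurable_EFinP; apply: measurableT_comp => //.
  apply: measurable_funB; last exact: measurable_level.
  by apply: measurable_smear_opp => //; exact: measurableT_comp.
have mitv p q : measurable (`[p, q]%classic : set (measurableTypeR R)).
  exact: measurable_itv.
have -> := fubini_tonelli_on _ _ _ _ _ lebesgue_measure lebesgue_measure
  _ _ F1 (mitv l0 r0) (mitv (b rp) (b lp)) mF1 F10.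
have mS : measurable_fun setT
    (fun z => \int[lebesgue_measure]_(u in `[A, C]) F2 (z, u))%E.
  exact: measurable_integral_section.
have S0 z : (0 <= \int[lebesgue_measure]_(u in `[A, C]) F2 (z, u))%E.
  exact: integral_ge0.
apply: (@le_trans _ _ (\int[lebesgue_measure]_(z in `[b rp, b lp])
    ((2 * ell)%:E + \int[lebesgue_measure]_(u in `[A, C]) F2 (z, u)))%E).
  apply: ge0_le_integral_nonmeasurable => [z _|z _]; first exact: integral_ge0.
  (* For fixed [z], the smoothed indicator in [x] is centred at the estimated inverse, and
     [level b z] jumps at [level_inv]. *)
  apply: (@le_trans _ _ (2 * ell + `|inv_est l0 r0 eps K h beta z
      - level_inv l0 r0 eps b z|)%:E).
    have xAC x : `[l0, r0]%classic x -> A <= x <= C.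
      rewrite /= in_itv/= /A /C /lpt /rpt => /andP[? ?].
      by have e0 := heps0; apply/andP; split; lra.
    apply: smear_step_error => //.
    - by move=> x; exact: level01.
    - by move=> x /xAC xI xz; rewrite /level (lt_level_inv mb b_anti x z).
    - move=> x /xAC xI xz; rewrite /level ltNge.
      by rewrite (gt_level_inv mb b_anti x z).
  by rewrite EFinD leeD2l//; exact: dist_inv_est_level_inv.
rewrite ge0_integralD//; last 2 first.
- by move=> z _; rewrite lee_fin; lra.
- exact: measurable_funTS.
rewrite integral_cst_itv// -EFinM EFinD -addeA leeD2l//.
(* After this second exchange [u] is fixed: in [z] the smoothed indicator is centred at [beta u] and
   the step jumps at [b u]. *)
have -> := fubini_tonelli_on _ _ _ _ _ lebesgue_measure lebesgue_measure
  _ _ F2 (mitv (b rp) (b lp)) (mitv A C) mF2 F20.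
apply: (@le_trans _ _ (\int[lebesgue_measure]_(u in `[A, C])
    ((2 * h)%:E + `|beta u - b u|%:E))%E).
  apply: ge0_le_integral_nonmeasurable => [u _|u _]; first exact: integral_ge0.
  rewrite -EFinD; apply: (smear_step_error _ K h (beta u) (b u) _ (fun z => level b z u)) => //.
  - by move=> z; exact: level01.
  - by move=> z _ zb; rewrite /level zb.
  - by move=> z _ bz; rewrite /level ltNge ltW.
rewrite ge0_integralD//; last 2 first.
- by move=> z _; rewrite lee_fin; lra.
- apply: measurable_funTS; apply/measurable_EFinP.
  by apply: measurableT_comp => //; exact: measurable_funB.
by rewrite integral_cst_itv// -EFinM.
Qed.

(** The two end point errors have expectation at most [Rk] each, uniformly in [x], hence [Rk + Rk]
    times the length [r0 - l0]. The rest is bounded path by path by [integrated_path_error], whose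
    L1 term has expectation at most [(C - A) * Rk]. *)
Lemma integrated_error d (Omega : measurableType d) (P : probability Omega R)
    (bhat : Omega -> R -> R) (m ell h M : R) (Rk : \bar R) :
  0 < m -> 0 < ell -> 0 < h -> 0 <= M -> (0 <= Rk)%E ->
  measurable_fun setT (fun p : Omega * measurableTypeR R => bhat p.1 p.2) ->
  b rp - b lp <= - m * (rp - lp) ->
  (forall x, l0 <= x <= r0 -> `|b x| <= M) ->
  (forall u, (A <= u <= C)%R -> \int[P]_w `|bhat w u - b u|%:E <= Rk)%E ->
  (\int[lebesgue_measure]_(x in `[l0, r0])
     \int[P]_w `|btilde l0 r0 eps K m ell h bhat w x - b x|%:E <=
   ((M / (m / 2 * (rp - lp)) + 2) * (r0 - l0))%:E * (Rk + Rk) +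
   ((2 * ell * (b lp - b rp) + 2 * h * (C - A))%:E + (C - A)%:E * Rk))%E.
Proof.
move=> m0 ell0 h0 M0 Rk0 mbhat brate bM hRk.
have hlr' := hlr; have heps0' := heps0.
have rplp : 0 < rp - lp by rewrite /rp /lp /rpt /lpt; lra.
set C1 := M / _ + 2.
have C10 : 0 <= C1 by rewrite addr_ge0// divr_ge0// mulr_ge0 ?ltW// divr_gt0.
pose F (p : (measurableTypeR R * Omega) * measurableTypeR R) :=
  `|smear K ell (- inv_est l0 r0 eps K h (bhat p.1.2) p.2) (- p.1.1)
    - level b p.2 p.1.1|%:E.
have F0 p : (0 <= F p)%E by rewrite lee_fin.
have m11 : measurable_fun setT
    (fun q : (measurableTypeR R * Omega) * measurableTypeR R => q.1.1).
  exact: (measurableT_comp measurable_fst measurable_fst).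
have m12 : measurable_fun setT
    (fun q : (measurableTypeR R * Omega) * measurableTypeR R => (q.1.2, q.2)).
  apply: measurable_fun_pair => //.
  exact: (measurableT_comp measurable_snd measurable_fst).
have mF : measurable_fun setT F.
  apply/measurable_EFinP; apply: measurableT_comp => //.
  apply: measurable_funB; last exact: measurable_level.
  apply: measurable_smear_opp => //.
  exact (measurableT_comp
    (measurable_inv_est _ _ _ l0 r0 eps K bhat h hK h0 mbhat) m12).
have mitv p q : measurable (`[p, q]%classic : set (measurableTypeR R)).
  exact: measurable_itv.
pose G (p : measurableTypeR R * Omega) :=
  (\int[lebesgue_measure]_(z in `[b rp, b lp]) F (p, z))%E.
have mG : measurable_fun setT G by exact: measurable_integral_section.
have G0 p : (0 <= G p)%E by exact: integral_ge0.
have mbhatu u : measurable_fun setT (fun w => bhat w u).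
  have mu : measurable_fun setT (fun w : Omega => (w, u : measurableTypeR R)).
    exact: measurable_fun_pair.
  exact (measurableT_comp mbhat mu).
have mbhatw w : measurable_fun setT (bhat w).
  have mw : measurable_fun setT (fun u : measurableTypeR R => (w, u)).
    exact: measurable_fun_pair.
  exact (measurableT_comp mbhat mw).
have mdist u : measurable_fun setT (fun w => `|bhat w u - b u|%:E).
  apply/measurable_EFinP; apply: measurableT_comp => //.
  exact: measurable_funB.
pose E (p : Omega * measurableTypeR R) := `|bhat p.1 p.2 - b p.2|%:E.
have E0 p : (0 <= E p)%E by rewrite lee_fin.
have mE : measurable_fun setT E.
  apply/measurable_EFinP; apply: measurableT_comp => //.
  by apply: measurable_funB => //; exact: measurableT_comp.
have lp_in : A <= lp <= C by rewrite /A /C /lp /lpt /rpt; apply/andP; split; lra.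
have rp_in : A <= rp <= C by rewrite /A /C /rp /lpt /rpt; apply/andP; split; lra.
(* Monotonicity is used without establishing measurability of [btilde]; measurability is proved for
   the bounds, which have to be split and exchanged. *)
apply: (@le_trans _ _ (\int[lebesgue_measure]_(x in `[l0, r0])
    (C1%:E * (Rk + Rk) + \int[P]_w G (x, w)))%E).
  apply: ge0_le_integral_nonmeasurable => [x _|x].
    by apply: integral_ge0 => w _; rewrite lee_fin.
  rewrite /= in_itv/= => /andP[l0x xr0].
  apply: (@le_trans _ _ (\int[P]_w
      (C1%:E * (`|bhat w rp - b rp|%:E + `|bhat w lp - b lp|%:E) + G (x, w)))%E).
    apply: ge0_le_integral_nonmeasurable => [w _|w _]; first by rewrite lee_fin.
    rewrite -EFinD -EFinM; apply: path_error => //.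
    - exact: mulr_gt0.
    - by apply/andP; split; apply: b_anti; rewrite /A /C /lp /rp /lpt /rpt; lra.
    - by apply: bM; rewrite l0x xr0.
  rewrite ge0_integralD//; last 3 first.
  - by move=> w _; rewrite mule_ge0 ?lee_fin// adde_ge0// lee_fin.
  - by apply: measurable_funeM; exact: emeasurable_funD.
  - have mx : measurable_fun setT (fun w : Omega => (x : measurableTypeR R, w)).
      exact: measurable_fun_pair.
    exact (measurableT_comp mG mx).
  rewrite leeD2r// ge0_integralZl//; last 2 first.
  - exact: emeasurable_funD.
  - by move=> w _; rewrite adde_ge0// lee_fin.
  rewrite lee_wpmul2l ?lee_fin// ge0_integralD//.
  by rewrite leeD//; exact: hRk.
have mGP : measurable_fun setT (fun x => \int[P]_w G (x, w))%E.
  exact: measurable_integral_section.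
rewrite ge0_integralD//; last 3 first.
- by move=> x _; rewrite mule_ge0 ?lee_fin// adde_ge0.
- by move=> x _; exact: integral_ge0.
- exact: measurable_funTS.
rewrite integral_cst_itv ?(ltW hlr)// muleAC -EFinM leeD2l//.
(* With the expectation outermost, the inner double integral concerns a single path. *)
have -> := fubini_tonelli_on _ _ _ _ _ lebesgue_measure P
  _ _ G (mitv l0 r0) measurableT mG G0.
have -> : ((C - A)%:E * Rk = \int[lebesgue_measure]_(u in `[A, C]) Rk)%E.
  by rewrite integral_cst_itv// muleC.
have mS : measurable_fun setT
    (fun w => \int[lebesgue_measure]_(u in `[A, C]) E (w, u))%E.
  exact: measurable_integral_section.
apply: (@le_trans _ _ (\int[P]_w
   ((2 * ell * (b lp - b rp) + 2 * h * (C - A))%:E +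
    \int[lebesgue_measure]_(u in `[A, C]) E (w, u)))%E).
  apply: ge0_le_integral_nonmeasurable => [w _|w _]; first exact: integral_ge0.
  exact (integrated_path_error ell h (bhat w) ell0 h0 (mbhatw w)).
have cst0 : 0 <= 2 * ell * (b lp - b rp) + 2 * h * (C - A).
  by rewrite addr_ge0// mulr_ge0 ?subr_ge0// mulr_ge0// ltW.
rewrite ge0_integralD//; last by move=> w _; exact: integral_ge0.
rewrite integral_cst//= probability_setT mule1 leeD2l//.
(* With the expectation innermost, each [u] contributes a pointwise risk, at most [Rk]. *)
have -> := fubini_tonelli_on _ _ _ _ _ P lebesgue_measure
  _ _ E measurableT (mitv A C) mE E0.
apply: ge0_le_integral_nonmeasurable => [u _|u].
  by apply: integral_ge0 => w _; rewrite lee_fin.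
by rewrite /= in_itv/=; exact: hRk.
Qed.

End Integrated.

(** * Reduction to functions on the whole line, and the constant *)

(** A path is read only at the two end points [rpt r0 eps] and [lpt l0 eps] and, through [inv_est],
    on the large interval. It can therefore be replaced by its extension by zero, which is
    measurable on the whole product. *)
Lemma btilde_restrict (R : realType) (l0 r0 eps : R) (K : R -> R) (m ell h : R)
    (Omega : Type) (bhat : Omega -> R -> R) w x :
  l0 < r0 -> 0 < eps ->
  btilde l0 r0 eps K m ell h (fun w => bhat w \_ (Iset l0 r0 (2 * eps))) w x =
  btilde l0 r0 eps K m ell h bhat w x.
Proof.
move=> lr e0; set I := Iset l0 r0 (2 * eps).
have rpI : rpt r0 eps \in I.
  by rewrite mem_setE in_itv/= /rpt /lpt; apply/andP; split; lra.
have lpI : lpt l0 eps \in I.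
  by rewrite mem_setE in_itv/= /rpt /lpt; apply/andP; split; lra.
have patchE (f : R -> R) u : u \in I -> (f \_ I) u = f u by rewrite /patch => ->.
have invE : inv_est l0 r0 eps K h (bhat w \_ I) = inv_est l0 r0 eps K h (bhat w).
  apply/funext => z; rewrite /inv_est; congr (_ + _).
  by apply: eq_Rintegral => u uI; rewrite patchE.
have OE : Omega_bhat l0 r0 eps m (fun w => bhat w \_ I) =
    Omega_bhat l0 r0 eps m bhat.
  by apply/seteqP; split => w'; rewrite /Omega_bhat/= !patchE.
by rewrite /btilde /iso_est invE OE !patchE.
Qed.

Theorem proposition2p5 (R : realType) (l0 r0 eps : R) (K b : R -> R) (mb : R)
    (hlr : l0 < r0) (heps0 : 0 < eps) (heps1 : eps <= 1)
    (hK : is_kernel K)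
    (hb : C1_on (Iset l0 r0 (2 * eps)) b)
    (hmb : 0 < mb)
    (hdb : forall x, Iset l0 r0 (2 * eps) x ->
       derive_on (Iset l0 r0 (2 * eps)) b x <= - mb) :
  exists2 C : R, 0 < C &
    forall (d : measure_display) (Omega : measurableType d)
      (P : probability Omega R) (bhat : Omega -> R -> R),
      integrable_estimator P (Iset l0 r0 (2 * eps)) bhat ->
    forall ell h : R,
      0 < ell < Num.min 1 mb * eps ->
      0 < h < Num.min 1 mb * eps ->
      (\int[lebesgue_measure]_(x in `[l0, r0])
          'E_P[fun w => `|btilde l0 r0 eps K mb ell h bhat w x - b x|%R]
        <= C%:E * (ell%:E + h%:E
                   + risk P (Iset l0 r0 (2 * eps)) b bhat))%E.
Proof.
set I := Iset l0 r0 (2 * eps).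
set A := lpt l0 (2 * eps); set C := rpt r0 (2 * eps).
set lp := lpt l0 eps; set rp := rpt r0 eps.
have [Al lpl rrp rpC] : [/\ A < lp, lp < l0, r0 < rp & rp < C].
  by rewrite /A /C /lp /rp /lpt /rpt; split; lra.
have patchE (f : R -> R) u : A <= u <= C -> (f \_ I) u = f u.
  by move=> uI; rewrite /patch mem_setE in_itv/= uI.
have mI : measurable (I : set (measurableTypeR R)) by exact: measurable_itv.
case: hb => db _.
have rate x y : A <= x -> x <= y -> y <= C -> b y - b x <= - mb * (y - x).
  exact: derive_on_le_decreasing db hdb x y.
have anti x y : A <= x -> x <= y -> y <= C -> b y <= b x.
  move=> Ax xy yC; rewrite -subr_le0 (le_trans (rate _ _ Ax xy yC))//.
  by rewrite mulNr oppr_le0 mulr_ge0 ?subr_ge0// ltW.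
(* The integrated bound asks for global measurability, which the extension by zero has; it agrees
   with [b] on [[A, C]]. *)
pose b' : R -> R := b \_ I.
have b'E u : A <= u <= C -> b' u = b u by exact: patchE.
have mb' : measurable_fun setT b'.
  have mI' : measurable I by exact: measurable_itv.
  apply/(measurable_restrictT _ mI').
  by apply: subspace_continuous_measurable_fun => //; exact: derivable_on_continuous.
have anti' x y : A <= x -> x <= y -> y <= C -> b' y <= b' x.
  move=> Ax xy yC; rewrite !b'E ?Ax ?yC ?(le_trans xy) ?(le_trans Ax)//.
  exact: anti.
(* By monotonicity [b] lies between its values at [r0] and [l0] on the small interval. *)
pose M := `|b l0| + `|b r0|.
have M0 : 0 <= M by exact: addr_ge0.
have b'M x : l0 <= x <= r0 -> `|b' x| <= M.
  move=> /andP[lx xr]; rewrite b'E; last by apply/andP; split; lra.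
  have : b x <= b l0 by apply: anti; lra.
  have : b r0 <= b x by apply: anti; lra.
  rewrite /M; have := ler_norm (b l0); have := ler_norm (- b r0).
  have := normr_ge0 (b l0); have := normr_ge0 (b r0); rewrite normrN => ? ? ? ? ? ?.
  by rewrite ler_norml; apply/andP; split; lra.
have AlC : A <= lp <= C by apply/andP; split; lra.
have ArC : A <= rp <= C by apply/andP; split; lra.
have rate' : b' rp - b' lp <= - mb * (rp - lp).
  by rewrite !b'E//; apply: rate; lra.
pose X := (M / (mb / 2 * (rp - lp)) + 2) * (r0 - l0).
pose D := b' lp - b' rp.
pose L := C - A.
have X0 : 0 <= X.
  apply: mulr_ge0; last by rewrite subr_ge0 ltW.
  apply: addr_ge0 => //; apply: divr_ge0 => //.
  by apply: mulr_ge0; [rewrite divr_ge0// ltW|rewrite subr_ge0; lra].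
have D0 : 0 <= D by rewrite /D subr_ge0; apply: anti'; lra.
have L0 : 0 <= L by rewrite /L; lra.
(* In the bound of [integrated_error] the risk has coefficient [2 * X + L], [ell] has [2 * D] and
   [h] has [2 * L]. Their sum dominates each of them, and the added 1 makes it positive. *)
exists (2 * X + 2 * D + 3 * L + 1); first by lra.
move=> d Omega P bhat [mbhat _] ell h /andP[ell0 _] /andP[h0 _].
set Rk := risk _ _ _ _.
have hRk u : A <= u <= C -> (\int[P]_w `|bhat w u - b u|%:E <= Rk)%E.
  move=> uI; apply: ereal_sup_ubound; exists u; first by rewrite /I /Iset/= in_itv.
  by rewrite unlock.
have Rk0 : (0 <= Rk)%E.
  by apply: le_trans (hRk _ AlC); apply: integral_ge0 => w _; rewrite lee_fin.
pose bhat' w : R -> R := bhat w \_ I.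
have mbhat' : measurable_fun setT
    (fun p : Omega * measurableTypeR R => bhat' p.1 p.2).
  have mTI : measurable ([set: Omega] `*` (I : set (measurableTypeR R))).
    exact: measurableX.
  move/(measurable_restrictT _ mTI) : mbhat; congr measurable_fun.
  apply/funext => -[w u]; rewrite /bhat' /patch/=.
  by congr (if _ then _ else _); apply/idP/idP; rewrite !inE/= => // -[].
have hRk' u : A <= u <= C -> (\int[P]_w `|bhat' w u - b' u|%:E <= Rk)%E.
  by move=> uI; under eq_integral do rewrite /bhat' /b' !patchE//; exact: hRk.
have main := integrated_error hlr heps0 hK mb' anti' _ _ P bhat' mb ell h M Rk
  hmb ell0 h0 M0 Rk0 mbhat' rate' b'M hRk'.
apply: (@le_trans _ _ (X%:E * (Rk + Rk) +
   ((2 * ell * D + 2 * h * L)%:E + L%:E * Rk))%E).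
  apply: le_trans main; rewrite le_eqVlt; apply/orP; left; apply/eqP.
  apply: eq_integral => x; rewrite mem_setE in_itv/= => /andP[lx xr].
  rewrite unlock; apply: eq_integral => w _.
  by rewrite btilde_restrict// b'E//; apply/andP; split; lra.
(* An infinite risk makes the right-hand side infinite, since the constant is positive. A finite one
   leaves a real inequality, linear once the signs of the products are known. *)
clear main; move: Rk Rk0 {hRk hRk'} => [r| |]//; last first.
  move=> _; rewrite [leRHS](_ : _ = +oo%E) ?leey// addey// gt0_muley// lte_fin.
  lra.
rewrite lee_fin => r0'; rewrite -!(EFinD, EFinM) lee_fin.
have := mulr_ge0 X0 (ltW ell0); have := mulr_ge0 X0 (ltW h0).
have := mulr_ge0 D0 (ltW h0); have := mulr_ge0 D0 r0'.
have := mulr_ge0 L0 (ltW ell0); have := mulr_ge0 L0 (ltW h0).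
have := mulr_ge0 L0 r0'; have := mulr_ge0 X0 r0'.
have := mulr_ge0 D0 (ltW ell0); lra.
Qed.
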